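(* Let $\Gamma$ be a weighted Abelian Cayley graph with vertex set $V$, and for $t\in\mathbb{R}_{>0}$ let $H_t=e^{-tL}$ be its heat kernel, where $L$ is the graph Laplacian of $\Gamma$. Then $\Gamma$ has monotonic diffusion; that is, for all $t,t'\in\mathbb{R}_{>0}$ with $t\le t'$ and all vertices $u,v\in V$, $$\frac{H_t(u,v)}{H_t(u,u)}\le\frac{H_{t'}(u,v)}{H_{t'}(u,u)}.$$
   Context: A finite undirected weighted graph $\Gamma$ consists of a finite vertex set $V$ and a symmetric weight function $w:V\times V\to\mathbb{R}_{\ge 0}$ (with $w(u,v)=0$ when there is no edge between $u$ and $v$). Its graph Laplacian is the $V\times V$ matrix $L$ with $L(u,v)=-w(u,v)$ for $u\ne v$ and $L(u,u)=\sum_{v\neq u}w(u,v)$. The heat kernel is the matrix exponential $H_t=e^{-tL}$, with entries $H_t(u,v)$. The graph $\Gamma$ is called a weighted Abelian Cayley graph if it is a finite undirected weighted graph and there is an Abelian group structure on $V$ under which $\Gamma$ is translation-invariant, i.e. $w(u+x,v+x)=w(u,v)$ for all $u,v,x\in V$. *)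

(* Defs.v *)
From mathcomp Require Import all_boot all_order all_algebra.
From mathcomp Require Import classical_sets reals topology normedtype sequences.
Set Implicit Arguments.
Unset Strict Implicit.
Unset Printing Implicit Defensive.
Import Order.TTheory GRing.Theory Num.Theory.
Import numFieldNormedType.Exports.
Local Open Scope ring_scope.

(* The diagonal weights [weight G u u] are unconstrained; they do not enter the
   Laplacian. *)
Record wgraph (R : realType) (V : finType) := WGraph {
  weight :> V -> V -> R;
  weight_sym : forall u v, weight u v = weight v u;
  weight_ge0 : forall u v, 0 <= weight u v
}.

Definition abelian_group_law (V : Type) (add : V -> V -> V) (zero : V)
    (opp : V -> V) : Prop :=
  [/\ associative add, commutative add, left_id zero add
    & left_inverse zero opp add].

Definition abelian_cayley (R : realType) (V : finType) (G : wgraph R V) : Prop :=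
  exists (add : V -> V -> V) (zero : V) (opp : V -> V),
    abelian_group_law add zero opp /\
    (forall u v x : V, G (add u x) (add v x) = G u v).

(* V x V matrices are represented as square matrices of size #|V|, a vertex v
   being identified with its rank [enum_rank v] in the enumeration of V. *)
Definition laplacian (R : realType) (V : finType) (G : wgraph R V) :
    'M[R]_#|V| :=
  \matrix_(i, j)
    let u := enum_val i in let v := enum_val j in
    if u == v then \sum_(z | z != u) G u z else - G u v.

(* The limit is taken in the topology of 'M[R]_n (uniform convergence of the
   entries); the powers are for the matrix product. *)
Definition expmx (R : realType) (n : nat) (A : 'M[R]_n) : 'M[R]_n :=
  limn (series (fun k : nat => (k`!%:R)^-1 *: A ^+ k)).

Definition heat_kernel (R : realType) (V : finType) (G : wgraph R V) (t : R)
    (u v : V) : R :=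
  expmx (- t *: laplacian G) (enum_rank u) (enum_rank v).

Definition monotonic_diffusion (R : realType) (V : finType) (G : wgraph R V) :
    Prop :=
  forall t t' : R, 0 < t -> 0 < t' -> t <= t' -> forall u v : V,
    heat_kernel G t u v / heat_kernel G t u u
      <= heat_kernel G t' u v / heat_kernel G t' u u.

(* Main.v *)
Require Import Defs.
From HB Require Import structures.
From mathcomp Require Import all_boot all_order all_algebra.
From mathcomp Require Import reals.
From mathcomp Require Import boolp classical_sets filter topology normedtype.
From mathcomp Require Import sequences exp.
From mathcomp Require Import ring lra.

(** Write the group additively and put [w s := G 0 s] for [s != 0], [w 0 := 0].
    The Laplacian is a scalar matrix minus the convolution matrix of [w], so up
    to a factor which depends on [t] only, and which cancels in the quotient,
    [H_t u v] is [p_t (v - u)], where [p_t] is the exponential of [t w] for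
    convolution.  It must be shown that [p_t x / p_t 0] is nondecreasing in [t].

    For [t <= t'] one has [p_t' = p_t * q] with [q := p_(t' - t)] even and
    nonnegative.  Averaging over [y] and [- y] gives
      [2 p_t' x = sum_y q y (p_t (x + y) + p_t (x - y))],
    so the theorem follows, term by term in [y], from the correlation inequality
      [2 p x p y <= p 0 (p (x + y) + p (x - y))]             ([ginibre_inequality])
    for the convolution exponential [p] of an even nonnegative weight.  On the
    dual group this is Ginibre's inequality, which says that the cosines of two
    characters are positively correlated for a Gibbs weight [exp (sum of cosines)].
    The proof below stays on the group itself.  The inequality is an instance of
    the statement that, for every [S] in the group, the matrix
      [K_S (a, b) := p (a - b) p (S - a - b)]
    is positive semidefinite: test it with [S = x + y] on the difference of the
    point masses at [0] and [x].

    For the semidefiniteness ([ginibre_form_exp]), expand [p u p v] as an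
    exponential series.  Its [n]-th coefficient [Q_n (u, v)] counts the weighted
    [n]-step walks from [(0, 0)] to [(u, v)] in which each step moves one of the
    two coordinates.  Each [Q_n] has the same property, by induction on [n]: in
    the rotated coordinates [u = a - b], [v = S - a - b], the four moves [u + s],
    [u - s], [v + s], [v - s] come from translating [a], [b], neither or both, so
    applying all four of them to the quadratic form of [f] at [S] gives the
    quadratic form of [f + f (. - s)] at [S + s] ([ginibre_form_step]).

    The analysis consists in showing that products of exponential series are
    given by binomial convolution of their coefficients ([cvg_egf_binconv]); this
    gives both [exp (A + B) = exp A exp B] for commuting matrices and the
    expansion of [p u p v]. *)

Set Implicit Arguments.
Unset Strict Implicit.
Unset Printing Implicit Defensive.
Import Order.TTheory GRing.Theory Num.Theory.
Import numFieldNormedType.Exports.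
Local Open Scope ring_scope.
Local Open Scope classical_set_scope.

(** * Exponential series with geometrically bounded coefficients *)

Section Egf.
Variable R : realType.
Implicit Types (a b : nat -> R) (l m : R).

Definition egf_series a : nat -> R := series (fun n => (n`!%:R)^-1 * a n).

Definition geom_bounded a := exists c : R, forall n, `|a n| <= c ^+ n.

Definition binconv a b n : R :=
  \sum_(k < n.+1) 'C(n, k)%:R * (a k * b (n - k)%N).

Lemma egf_series_pow (c : R) : egf_series (fun n => c ^+ n) @ \oo --> expR c.
Proof.
rewrite (_ : egf_series _ = series (exp_coeff c)).
  exact: is_cvg_series_exp_coeff.
by congr series; apply/funext => n; rewrite mulrC.
Qed.

Lemma is_cvg_egf_series a : geom_bounded a -> cvgn (egf_series a).
Proof.
case=> c ac; apply: normed_cvg.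
apply: (@series_le_cvg _ _ (fun n => (n`!%:R)^-1 * c ^+ n)).
- by move=> n /=; rewrite normr_ge0.
- by move=> n; rewrite mulr_ge0 ?invr_ge0 ?ler0n// (le_trans _ (ac n)).
- move=> n /=; rewrite normrM ger0_norm ?invr_ge0 ?ler0n//.
  by rewrite ler_wpM2l ?invr_ge0 ?ler0n.
- by apply/cvg_ex; exists (expR c); exact: egf_series_pow.
Qed.

(** Products of partial sums are sums over squares of indices; those of the
    binomial convolution are sums over triangles. *)
Lemma egf_series_binconvE a b N :
  egf_series (binconv a b) N =
  \sum_(0 <= i < N) \sum_(0 <= j < N - i)
    ((i`!%:R)^-1 * a i) * ((j`!%:R)^-1 * b j).
Proof.
rewrite /egf_series /series /=; elim: N => [|N IH]; first by rewrite !big_geq.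
rewrite big_nat_recr //= IH big_nat_recr //= subSnn big_nat1.
have -> : \sum_(0 <= i < N) \sum_(0 <= j < N.+1 - i)
    ((i`!%:R)^-1 * a i) * ((j`!%:R)^-1 * b j) =
  \sum_(0 <= i < N) (\sum_(0 <= j < N - i)
    ((i`!%:R)^-1 * a i) * ((j`!%:R)^-1 * b j)
     + ((i`!%:R)^-1 * a i) * (((N - i)`!%:R)^-1 * b (N - i)%N)).
  apply: eq_big_nat => i /andP[_ iN].
  by rewrite subSn 1?ltnW// big_nat_recr.
rewrite big_split /= -addrA; congr (_ + _).
rewrite /binconv mulr_sumr.
rewrite -(big_mkord xpredT
  (fun k => (N`!%:R)^-1 * ('C(N, k)%:R * (a k * b (N - k)%N)))).
rewrite big_nat_recr //= binn subnn fact0; congr (_ + _); last first.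
  by rewrite invr1; ring.
apply: eq_big_nat => i /andP[_ iN].
have fN0 k : (k`!%:R : R) != 0 by rewrite pnatr_eq0 -lt0n fact_gt0.
rewrite -(bin_fact (ltnW iN)) !natrM !invfM.
have : ('C(N, i)%:R : R) != 0 by rewrite pnatr_eq0 -lt0n bin_gt0 ltnW.
by move=> C0; field; rewrite C0 !fN0.
Qed.

Lemma egf_series_binconv_diff a b N :
  egf_series a N * egf_series b N - egf_series (binconv a b) N =
  \sum_(0 <= i < N) \sum_(N - i <= j < N)
    ((i`!%:R)^-1 * a i) * ((j`!%:R)^-1 * b j).
Proof.
rewrite egf_series_binconvE {1 2}/egf_series /series /=.
apply/eqP; rewrite subr_eq; apply/eqP; rewrite -big_split /= mulr_suml.
apply: eq_big_nat => i /andP[_ iN].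
by rewrite mulr_sumr addrC -big_cat_nat ?leq_subr.
Qed.

Lemma binconv_pow (c d : R) n :
  binconv (fun k => c ^+ k) (fun k => d ^+ k) n = (c + d) ^+ n.
Proof.
rewrite addrC exprDn; apply: eq_bigr => k _.
by rewrite mulr_natl [in LHS]mulrC.
Qed.

Lemma geom_bounded_binconv a b :
  geom_bounded a -> geom_bounded b -> geom_bounded (binconv a b).
Proof.
case=> c ac [d bd]; exists (c + d) => n; rewrite -binconv_pow.
apply: (le_trans (ler_norm_sum _ _ _)); apply: ler_sum => k _.
by rewrite normrM normr_nat ler_wpM2l// normrM ler_pM.
Qed.

(** The difference between the square and the triangle is dominated by the same
    difference for two sequences of powers of scalars, and the latter tends to
    [expR c * expR d - expR (c + d) = 0]. *)
Lemma cvg_egf_binconv a b l m : geom_bounded a -> geom_bounded b ->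
  egf_series a @ \oo --> l -> egf_series b @ \oo --> m ->
  egf_series (binconv a b) @ \oo --> l * m.
Proof.
move=> [c ac] [d bd] al bm.
pose D a b N := egf_series a N * egf_series b N - egf_series (binconv a b) N.
pose pc n := c ^+ n; pose pd n := d ^+ n.
have Dcd : D pc pd @ \oo --> 0.
  rewrite -[0](subrr (expR (c + d))) {1}expRD; apply: cvgB.
    by apply: cvgM; exact: egf_series_pow.
  rewrite (_ : binconv pc pd = fun n => (c + d) ^+ n); last first.
    by apply/funext => n; exact: binconv_pow.
  exact: egf_series_pow.
have Dab : D a b @ \oo --> 0.
  apply: norm_cvg0; apply: (@squeeze_cvgr _ _ _ _ (fun=> 0) (D pc pd)) => //;
    last exact: cvg_cst.
  apply: nearW => N; rewrite normr_ge0 /= /D !egf_series_binconv_diff.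
  apply: (le_trans (ler_norm_sum _ _ _)); apply: ler_sum => i _.
  apply: (le_trans (ler_norm_sum _ _ _)); apply: ler_sum => j _.
  have P (x y : R) k : `|x| <= y -> `|(k`!%:R)^-1 * x| <= (k`!%:R)^-1 * y.
    move=> xy; rewrite normrM ger0_norm ?invr_ge0 ?ler0n//.
    by rewrite ler_wpM2l ?invr_ge0 ?ler0n.
  by rewrite normrM ler_pM// P.
rewrite (_ : egf_series (binconv a b) =
  fun N => egf_series a N * egf_series b N - D a b N); last first.
  by apply/funext => N; rewrite /D; ring.
by rewrite -[l * m]subr0; apply: cvgB => //; apply: cvgM.
Qed.

Lemma cvg_egf_sum (I : finType) (u : I -> nat -> R) (l : I -> R) :
  (forall i, egf_series (u i) @ \oo --> l i) ->
  egf_series (fun n => \sum_i u i n) @ \oo --> \sum_i l i.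
Proof.
move=> ul; rewrite (_ : egf_series _ = fun n => \sum_i egf_series (u i) n).
  by apply: cvg_big => //; exact: add_continuous.
apply/funext => n; rewrite /egf_series /series /= exchange_big /=.
by apply: eq_bigr => k _; rewrite mulr_sumr.
Qed.

Lemma cvg_egfZ (c : R) a l : egf_series a @ \oo --> l ->
  egf_series (fun n => c * a n) @ \oo --> c * l.
Proof.
move=> al; rewrite (_ : egf_series _ = fun n => c * egf_series a n).
  by apply: cvgMr.
apply/funext => n; rewrite /egf_series /series /= mulr_sumr.
by apply: eq_bigr => k _; rewrite mulrCA.
Qed.

Lemma cvg_egf_ge a l N : (forall n, 0 <= a n) -> egf_series a @ \oo --> l ->
  egf_series a N <= l.
Proof.
move=> a0 al; apply: (cvgr_to_ge al).
exists N => // n /= Nn; rewrite /egf_series.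
apply: nondecreasing_series => // k _ _.
by rewrite mulr_ge0// invr_ge0.
Qed.

(** Pascal's rule, in the form of the Leibniz rule for the shift. *)
Lemma binconvS a b n : binconv a b n.+1 =
  binconv (fun k => a k.+1) b n + binconv a (fun k => b k.+1) n.
Proof.
rewrite /binconv big_ord_recl /= bin0 subn0.
under eq_bigr => i _ do rewrite /bump /= add1n binS natrD mulrDl subSS.
rewrite big_split /= addrA addrC; congr (_ + _).
(* ['C(n, n.+1) = 0] removes the last term on the left; the term of index [0]
   on the right is the one that was split off at the start *)
rewrite [in LHS]big_ord_recr /= bin_small// mul0r addr0.
rewrite [in RHS]big_ord_recl /= bin0 subn0; congr (_ + _).
by apply: eq_bigr => i _; rewrite /bump /= add1n subnSK// subSn.
Qed.

End Egf.

(** * The matrix exponential *)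

Section MatrixExp.
Variables (R : realType) (n : nat).
Implicit Types A B : 'M[R]_n.

Lemma cvg_mx (M : nat -> 'M[R]_n) (L : 'M[R]_n) :
  (forall i j, (fun k => M k i j) @ \oo --> L i j) -> M @ \oo --> L.
Proof.
move=> ML; apply/cvg_ballP => e e0.
have : \forall k \near \oo, forall i j, ball (L i j) e (M k i j).
  apply: filter_forall => i; apply: filter_forall => j.
  by move/cvg_ballP : (ML i j); apply.
by apply: filterS => k Lk; split.
Qed.

(** The sum of all the absolute values of the entries, unlike their maximum, is a
    submultiplicative norm which bounds every entry. *)
Lemma geom_bounded_mxpow A i j : geom_bounded (fun k => (A ^+ k) i j).
Proof.
pose c := \sum_i \sum_j `|A i j|.
exists c => k; elim: k i j => [|k IH] i j.
  by rewrite !expr0 mxE; case: (i == j); rewrite ?normr1 ?normr0.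
rewrite exprS mxE (le_trans (ler_norm_sum _ _ _))//.
have c0 : 0 <= c by do 2!(apply: sumr_ge0 => ? _).
apply: (@le_trans _ _ (\sum_l `|A i l| * c ^+ k)).
  by apply: ler_sum => l _; rewrite normrM ler_wpM2l.
rewrite -mulr_suml exprS ler_wpM2r ?exprn_ge0//.
rewrite /c [leRHS](bigD1 i)//= lerDl.
by do 2!(apply: sumr_ge0 => ? _).
Qed.

Lemma expmx_entry A i j :
  egf_series (fun k => (A ^+ k) i j) @ \oo --> expmx A i j.
Proof.
pose L := \matrix_(i, j) limn (egf_series (fun k => (A ^+ k) i j)).
suff -> : expmx A = L.
  by rewrite mxE; apply: is_cvg_egf_series; exact: geom_bounded_mxpow.
apply/cvg_lim => //; apply: cvg_mx => p q.
rewrite (_ : (fun k => _) = egf_series (fun k => (A ^+ k) p q)).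
  by rewrite mxE; apply: is_cvg_egf_series; exact: geom_bounded_mxpow.
apply/funext => k; rewrite /egf_series /series /= summxE.
by apply: eq_bigr => l _; rewrite mxE.
Qed.

Lemma expmx_eq A i j l :
  egf_series (fun k => (A ^+ k) i j) @ \oo --> l -> expmx A i j = l.
Proof. by move=> /cvg_lim <- //; rewrite (cvg_lim _ (@expmx_entry A i j)). Qed.

Lemma expmxD A B : A *m B = B *m A -> expmx (A + B) = expmx A *m expmx B.
Proof.
move=> AB; apply/matrixP => i j; apply: expmx_eq; rewrite mxE.
rewrite (_ : (fun k => _) = fun k => \sum_l
  binconv (fun p => (A ^+ p) i l) (fun q => (B ^+ q) l j) k).
  apply: cvg_egf_sum => l.
  by apply: cvg_egf_binconv; try exact: geom_bounded_mxpow; exact: expmx_entry.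
apply/funext => k; rewrite addrC exprDn_comm; last exact: esym.
rewrite summxE exchange_big /=; apply: eq_bigr => p _.
rewrite -mulr_sumr mulmxnE mulr_natl.
suff -> : B ^+ (k - p) * A ^+ p = A ^+ p *m B ^+ (k - p) by rewrite mxE.
by apply: (@commrX 'M[R]_n); apply/commr_sym/commrX.
Qed.

Lemma expmx_scalar (a : R) : expmx (a%:M : 'M[R]_n) = (expR a)%:M.
Proof.
apply/matrixP => i j; apply: expmx_eq; rewrite mxE.
rewrite (_ : (fun k => _) = fun k => (i == j)%:R * a ^+ k).
  by rewrite -(mulr_natl (expR a)); exact: cvg_egfZ (@egf_series_pow R a).
apply/funext => k; rewrite mulr_natl.
suff -> : (a%:M : 'M[R]_n) ^+ k = (a ^+ k)%:M by rewrite mxE.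
elim: k => [|k IH]; first by rewrite !expr0.
by rewrite exprS IH exprS scalar_mxM.
Qed.

End MatrixExp.

(** * Convolution powers and exponentials on a finite abelian group *)

Section Convolution.
Variables (R : realType) (V : finZmodType).
Implicit Types (w f : V -> R) (u v x y S : V).

Fixpoint conv_pow w n x : R :=
  if n is n'.+1 then \sum_s w s * conv_pow w n' (x - s) else (x == 0)%:R.

Lemma conv_pow_ge0 w n x : (forall s, 0 <= w s) -> 0 <= conv_pow w n x.
Proof.
move=> w0; elim: n x => [|n IH] x /=; first exact: ler0n.
by apply: sumr_ge0 => s _; rewrite mulr_ge0.
Qed.

Lemma conv_powN w n x : (forall s, w (- s) = w s) ->
  conv_pow w n (- x) = conv_pow w n x.
Proof.
move=> wN; elim: n x => [|n IH] x /=; first by rewrite oppr_eq0.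
rewrite (reindex_inj (@oppr_inj V)) /=; apply: eq_bigr => s _.
by rewrite wN -opprD IH.
Qed.

Definition conv_mx w : 'M[R]_#|V| :=
  \matrix_(i, j) w (enum_val j - enum_val i).

Lemma sum_shift (h : V -> R) (s : V) : \sum_a h (a - s) = \sum_a h a.
Proof.
by rewrite (reindex_inj (addIr s)) /=; apply: eq_bigr => a _; rewrite addrK.
Qed.

Lemma conv_mx_pow w k i j :
  (conv_mx w ^+ k) i j = conv_pow w k (enum_val j - enum_val i).
Proof.
elim: k i j => [|k IH] i j.
  by rewrite expr0 mxE /= subr_eq0 (inj_eq enum_val_inj) eq_sym.
rewrite exprS mxE /= -(sum_shift _ (enum_val i)).
rewrite (reindex _ (onW_bij _ (enum_rank_bij V))) /=.
apply: eq_bigr => s _; rewrite mxE IH enum_rankK; congr (_ * conv_pow w k _).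
by rewrite opprB addrA subrK.
Qed.

Lemma geom_bounded_conv_pow w x : geom_bounded (fun k => conv_pow w k x).
Proof.
have [c wc] := geom_bounded_mxpow (conv_mx w) (enum_rank 0) (enum_rank x).
by exists c => k; have := wc k; rewrite conv_mx_pow !enum_rankK subr0.
Qed.

Definition conv_exp w x : R := limn (egf_series (fun k => conv_pow w k x)).

Lemma cvg_conv_exp w x :
  egf_series (fun k => conv_pow w k x) @ \oo --> conv_exp w x.
Proof. by apply: is_cvg_egf_series; exact: geom_bounded_conv_pow. Qed.

Lemma expmx_conv_mx w i j :
  expmx (conv_mx w) i j = conv_exp w (enum_val j - enum_val i).
Proof.
apply: expmx_eq; under eq_fun do rewrite conv_mx_pow.
exact: cvg_conv_exp.
Qed.

Lemma conv_expN w x : (forall s, w (- s) = w s) ->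
  conv_exp w (- x) = conv_exp w x.
Proof.
by move=> wN; rewrite /conv_exp; under eq_fun do rewrite conv_powN//.
Qed.

Lemma conv_exp_ge0 w x : (forall s, 0 <= w s) -> 0 <= conv_exp w x.
Proof.
move=> w0; have := cvg_egf_ge 0%N _ (cvg_conv_exp (w := w) (x := x)).
rewrite /egf_series /series /= big_geq//; apply=> k.
exact: conv_pow_ge0.
Qed.

Lemma conv_exp0_gt0 w : (forall s, 0 <= w s) -> 0 < conv_exp w 0.
Proof.
move=> w0; have := cvg_egf_ge 1%N _ (cvg_conv_exp (w := w) (x := 0)).
rewrite /egf_series /series /= big_nat1 /= eqxx invr1 mulr1.
by move=> H; apply: lt_le_trans ltr01 (H _) => k; exact: conv_pow_ge0.
Qed.

(** Inherited from [expmxD], as convolution matrices are commuting multiples of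
    one matrix here. *)
Lemma conv_expD w (a b : R) x :
  conv_exp (fun s => (a + b) * w s) x =
  \sum_y conv_exp (fun s => a * w s) (x - y) * conv_exp (fun s => b * w s) y.
Proof.
have cZ c : conv_mx (fun s => c * w s) = c *: conv_mx w.
  by apply/matrixP => i j; rewrite !mxE.
have E z c : conv_exp (fun s => c * w s) z =
    expmx (c *: conv_mx w) (enum_rank 0) (enum_rank z).
  by rewrite -cZ expmx_conv_mx !enum_rankK subr0.
rewrite E addrC scalerDl expmxD; last first.
  by rewrite -!scalemxAl -!scalemxAr !scalerA mulrC.
rewrite mxE (reindex _ (onW_bij _ (enum_rank_bij V))) /=.
apply: eq_bigr => y _; rewrite -E mulrC -cZ expmx_conv_mx !enum_rankK//.
Qed.

(** * The Ginibre inequality *)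

(** The [n]-th power of [w] acting on two independent copies of the group: the
    [n]-th convolution power, on [V * V], of the weight that puts [w s] at both
    [(s, 0)] and [(0, s)]. *)
Definition duplicate_pow w n u v : R :=
  binconv (fun k => conv_pow w k u) (fun k => conv_pow w k v) n.

(** Recursion on the last step of the walk, averaged over [s] and [- s] so that
    the four moves required by [ginibre_form_step] appear together. *)
Lemma duplicate_powS w n u v : (forall s, w (- s) = w s) ->
  duplicate_pow w n.+1 u v = 2^-1 * \sum_s w s *
    (duplicate_pow w n (u + s) v + duplicate_pow w n (u - s) v
     + duplicate_pow w n u (v + s) + duplicate_pow w n u (v - s)).
Proof.
move=> wN.
have E : duplicate_pow w n.+1 u v = \sum_s w s *
    (duplicate_pow w n (u - s) v + duplicate_pow w n u (v - s)).
  rewrite /duplicate_pow binconvS /binconv /=.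
  under [in RHS]eq_bigr => s _ do rewrite -big_split mulr_sumr.
  rewrite -big_split exchange_big /=; apply: eq_bigr => k _.
  rewrite mulr_suml !mulr_sumr -big_split /=.
  by apply: eq_bigr => s _; ring.
have E' : duplicate_pow w n.+1 u v = \sum_s w s *
    (duplicate_pow w n (u + s) v + duplicate_pow w n u (v + s)).
  rewrite E (reindex_inj (@oppr_inj V)) /=; apply: eq_bigr => s _.
  by rewrite wN opprK.
have -> : \sum_s w s *
    (duplicate_pow w n (u + s) v + duplicate_pow w n (u - s) v
     + duplicate_pow w n u (v + s) + duplicate_pow w n u (v - s)) =
  duplicate_pow w n.+1 u v + duplicate_pow w n.+1 u v.
  rewrite [X in X + _]E E' -big_split /=; apply: eq_bigr => s _; ring.
by field.
Qed.

(** The quadratic form of [q] in the rotated coordinates [u = a - b],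
    [v = S - a - b].  As [2] need not be invertible in the group, these only
    reach the pairs with [S - (u + v)] in twice the group; letting [S] vary
    covers the other classes. *)
Definition ginibre_form (q : V -> V -> R) S f : R :=
  \sum_a \sum_b f a * f b * q (a - b) (S - a - b).

(** Expanding the product [(f a + f (a - s)) * (f b + f (b - s))] gives four sums;
    translating [a] or [b] by [s] in them yields the four moves:
    [f a * f b] gives [v + s], [f a * f (b - s)] gives [u - s],
    [f (a - s) * f b] gives [u + s] and [f (a - s) * f (b - s)] gives [v - s]. *)
Lemma ginibre_form_step (q : V -> V -> R) S f s :
  ginibre_form (fun u v => q (u + s) v + q (u - s) v + q u (v + s) + q u (v - s))
    S f = ginibre_form q (S + s) (fun a => f a + f (a - s)).
Proof.
pose T g h := \sum_a \sum_b (g a * h b * q (a - b) (S + s - a - b) : R).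
pose fs a := f (a - s).
have -> : ginibre_form q (S + s) (fun a => f a + f (a - s))
    = T f f + T f fs + T fs f + T fs fs.
  rewrite /T -!big_split; apply: eq_bigr => a _ /=.
  rewrite -!big_split; apply: eq_bigr => b _ /=; rewrite /fs; ring.
have -> : T f fs = \sum_a \sum_b f a * f b * q (a - b - s) (S - a - b).
  apply: eq_bigr => a _.
  rewrite -(sum_shift (fun b => f a * f b * q (a - b - s) (S - a - b)) s).
  apply: eq_bigr => b _; rewrite /fs; congr (_ * q _ _).
    by rewrite opprB addrAC addrA subrK.
  by rewrite opprB addrA [S + s - a]addrAC.
have -> : T fs f = \sum_a \sum_b f a * f b * q (a - b + s) (S - a - b).
  rewrite -(sum_shift (fun a => \sum_b f a * f b * q (a - b + s) (S - a - b)) s).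
  apply: eq_bigr => a _.
  apply: eq_bigr => b _; rewrite /fs; congr (_ * q _ _).
    by rewrite addrAC subrK.
  by rewrite opprB addrA.
have -> : T fs fs = \sum_a \sum_b f a * f b * q (a - b) (S - a - b - s).
  rewrite -(sum_shift (fun a => \sum_b f a * f b * q (a - b) (S - a - b - s)) s).
  apply: eq_bigr => a _.
  rewrite -(sum_shift
    (fun b => f (a - s) * f b * q (a - s - b) (S - (a - s) - b - s)) s).
  apply: eq_bigr => b _; rewrite /fs; congr (_ * q _ _).
    by rewrite opprB addrA subrK.
  by rewrite !opprB !addrA [_ - b - s]addrAC addrK.
rewrite /T /ginibre_form -!big_split; apply: eq_bigr => a _ /=.
rewrite -!big_split; apply: eq_bigr => b _ /=.
have -> : S + s - a - b = S - a - b + s by rewrite [S + s - a]addrAC [LHS]addrAC.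
ring.
Qed.

(** Without any step, the form is the sum of the squares [f a ^ 2] over the [a]
    such that [2 a = S]; each step turns it into a nonnegative combination of
    forms of the same kind. *)
Lemma ginibre_form_duplicate w n S f :
  (forall s, w (- s) = w s) -> (forall s, 0 <= w s) ->
  0 <= ginibre_form (duplicate_pow w n) S f.
Proof.
move=> wN w0; elim: n S f => [|n IH] S f.
  apply: sumr_ge0 => a _; rewrite (bigD1 a) //= big1 ?addr0.
    by rewrite mulr_ge0 ?sqr_ge0// /duplicate_pow /binconv big_ord1 !mulr_ge0.
  move=> b ba; rewrite /duplicate_pow /binconv big_ord1 /=.
  by rewrite subr_eq0 eq_sym (negbTE ba) mul0r !mulr0.
have -> : ginibre_form (duplicate_pow w n.+1) S f =
  2^-1 * \sum_s w s * ginibre_form (duplicate_pow w n) (S + s)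
     (fun a => f a + f (a - s)).
  under [in RHS]eq_bigr => s _ do rewrite -ginibre_form_step mulr_sumr.
  rewrite exchange_big mulr_sumr /=; apply: eq_bigr => a _.
  under [in RHS]eq_bigr => s _ do rewrite mulr_sumr.
  rewrite exchange_big mulr_sumr /=; apply: eq_bigr => b _.
  rewrite duplicate_powS// mulrCA mulr_sumr; congr (_ * _).
  by apply: eq_bigr => s _; rewrite mulrCA.
by rewrite mulr_ge0 ?invr_ge0// sumr_ge0// => s _; rewrite mulr_ge0.
Qed.

Lemma ginibre_form_exp w S f :
  (forall s, w (- s) = w s) -> (forall s, 0 <= w s) ->
  0 <= ginibre_form (fun u v => conv_exp w u * conv_exp w v) S f.
Proof.
move=> wN w0.
have : egf_series (fun n => ginibre_form (duplicate_pow w n) S f) @ \oo -->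
    ginibre_form (fun u v => conv_exp w u * conv_exp w v) S f.
  apply: cvg_egf_sum => a; apply: cvg_egf_sum => b; apply: cvg_egfZ.
  by apply: cvg_egf_binconv; (exact: geom_bounded_conv_pow || exact: cvg_conv_exp).
move=> /(cvg_egf_ge 0%N); rewrite /egf_series /series /= big_geq//.
by apply=> n; exact: ginibre_form_duplicate.
Qed.

(** The form at [S = x + y] of the difference of the point masses at [0] and [x]:
    the diagonal terms are [p 0 * p (x + y)] and [p 0 * p (y - x)], the two other
    ones [p x * p y]. *)
Lemma ginibre_inequality w x y :
  (forall s, w (- s) = w s) -> (forall s, 0 <= w s) ->
  2 * (conv_exp w x * conv_exp w y) <=
  conv_exp w 0 * (conv_exp w (x + y) + conv_exp w (x - y)).
Proof.
move=> wN w0; set p := conv_exp w.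
have pN z : p (- z) = p z by exact: conv_expN.
have [->|x0] := eqVneq x 0.
  by rewrite sub0r add0r pN; lra.
have := ginibre_form_exp (x + y) (fun a => (a == 0)%:R - (a == x)%:R) wN w0.
rewrite -/p; have S2 (h : V -> R) :
    \sum_a ((a == 0)%:R - (a == x)%:R) * h a = h 0 - h x.
  rewrite (bigD1 0)//= (bigD1 x)//= big1 => [|a /andP[/negbTE -> /negbTE ->]].
    by rewrite !eqxx (negbTE x0) eq_sym (negbTE x0) /=; ring.
  by rewrite subrr mul0r.
rewrite /ginibre_form.
under eq_bigr => a _ do
  (under eq_bigr => b _ do rewrite -mulrA; rewrite -mulr_sumr S2).
rewrite S2 !subr0 subrr !sub0r pN.
have -> : x + y - x = y by rewrite addrC addrA addNr add0r.
have -> : y - x = - (x - y) by rewrite opprB.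
by rewrite pN; lra.
Qed.

(** After the decomposition [p t' = p t * p (t' - t)] the weight [p (t' - t)] is
    nonnegative, and the inequality holds for each value [y] of the added
    displacement. *)
Lemma conv_exp_ratio_le w (t t' : R) x : 0 <= t -> t <= t' ->
  (forall s, w (- s) = w s) -> (forall s, 0 <= w s) ->
  conv_exp (fun s => t * w s) x / conv_exp (fun s => t * w s) 0 <=
  conv_exp (fun s => t' * w s) x / conv_exp (fun s => t' * w s) 0.
Proof.
move=> t0 tt' wN w0; pose p c := conv_exp (fun s => c * w s).
have cw0 c : 0 <= c -> forall s, 0 <= c * w s by move=> c0 s; rewrite mulr_ge0.
have cwN c s : c * w (- s) = c * w s by rewrite wN.
have pN c z : p c (- z) = p c z by exact: conv_expN.
have p0 c : 0 <= c -> 0 < p c 0 by move=> c0; exact/conv_exp0_gt0/cw0.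
have q0 y : 0 <= p (t' - t) y by apply/conv_exp_ge0/cw0; rewrite subr_ge0.
have pD z : p t' z = \sum_y p t (z - y) * p (t' - t) y.
  by rewrite /p -conv_expD subrKC.
have pD' z : 2 * p t' z = \sum_y (p t (z + y) + p t (z - y)) * p (t' - t) y.
  rewrite mulr_natl mulr2n {1}pD (reindex_inj (@oppr_inj V)) pD -big_split /=.
  by apply: eq_bigr => y _; rewrite pN opprK -mulrDl.
rewrite -/(p t x) -/(p t 0) -/(p t' x) -/(p t' 0).
rewrite ler_pdivlMr ?p0 ?(le_trans t0)// mulrAC ler_pdivrMr ?p0//.
rewrite -(ler_pM2l (ltr0n R 2)) (mulrA 2 (p t' x)) pD' mulrCA pD'.
rewrite mulr_sumr mulr_suml.
apply: ler_sum => y _; rewrite add0r sub0r pN.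
rewrite mulrA [leRHS]mulrAC ler_wpM2r//.
have := ginibre_inequality x y (cwN t) (cw0 t t0); rewrite -!/(p t _); lra.
Qed.

End Convolution.

(** * Heat kernels of Cayley graphs *)

Section Cayley.
Variables (R : realType) (V : finZmodType) (G : wgraph R V).
Hypothesis Ginv : forall u v x : V, G (u + x) (v + x) = G u v.

(** The weight of a loop does not enter the Laplacian, so it is set to zero; the
    convolution matrix then has zero diagonal. *)
Definition step_weight (s : V) : R := if s == 0 then 0 else G 0 s.

Let GE u v : G u v = G 0 (v - u).
Proof. by rewrite -(Ginv u v (- u)) subrr. Qed.

Lemma step_weightN s : step_weight (- s) = step_weight s.
Proof.
by rewrite /step_weight oppr_eq0 weight_sym GE opprK add0r.
Qed.

Lemma step_weight_ge0 s : 0 <= step_weight s.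
Proof. by rewrite /step_weight; case: ifP => // _; exact: weight_ge0. Qed.

Lemma laplacian_cayley :
  laplacian G = (\sum_s step_weight s)%:M - conv_mx step_weight.
Proof.
apply/matrixP => i j; rewrite !mxE /= (inj_eq enum_val_inj).
case: eqVneq => [->|ij]; rewrite /step_weight.
  rewrite subrr eqxx subr0 mulr1n -(sum_shift _ (enum_val j)) big_mkcond /=.
  by apply: eq_bigr => z _; rewrite subr_eq0 -GE; case: eqP.
rewrite mulr0n sub0r subr_eq0 (inj_eq enum_val_inj) eq_sym (negbTE ij).
by rewrite -GE.
Qed.

Lemma heat_kernel_cayley t u v : heat_kernel G t u v =
  expR (- t * \sum_s step_weight s) * conv_exp (fun s => t * step_weight s) (v - u).
Proof.
rewrite /heat_kernel laplacian_cayley scalerBr (scaleNr t (conv_mx _)) opprK.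
rewrite scale_scalar_mx.
rewrite expmxD; last by rewrite scalar_mxC.
rewrite expmx_scalar mul_scalar_mx mxE.
suff -> : t *: conv_mx step_weight = conv_mx (fun s => t * step_weight s).
  by rewrite expmx_conv_mx !enum_rankK.
by apply/matrixP => i j; rewrite !mxE.
Qed.

Lemma monotonic_diffusion_zmod : monotonic_diffusion G.
Proof.
move=> t t' t0 _ tt' u v; rewrite !heat_kernel_cayley subrr.
rewrite -!mulf_div !divff ?gt_eqF ?expR_gt0// !mul1r.
by apply: conv_exp_ratio_le => //;
  [exact: ltW | exact: step_weightN | exact: step_weight_ge0].
Qed.

End Cayley.

Theorem theorem1p1 (R : realType) (V : finType) (G : wgraph R V)
    (hG : abelian_cayley G) : monotonic_diffusion G.
Proof.
(* The class of the finite type is destructed so that the finite type underlying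
   [Z] is convertible to [V], as the enumeration of [V] indexes the matrices. *)
case: V G hG => T [c1 c2 c3 c4] G hG.
case: hG => add [zero [opp [[addA addC add0 addN] Ginv]]].
pose Z : finZmodType :=
  HB.pack T c3 c1 c2 c4
    (GRing.isZmodule.Build (Finite.Pack (Finite.Class c1 c2 c4))
       addA addC add0 addN).
exact: (@monotonic_diffusion_zmod R Z G Ginv).
Qed.
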